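(* Let $M$ be a paracompact Hausdorff finite-dimensional smooth manifold, and let $\mathfrak{m}$ be the cardinality of the set of all connected components of $M$. Then $M$ is realcompact if and only if $\mathfrak{m}$ is not $\sigma$-measurable.
   Context: Manifolds are not required to be connected or second countable. For a topological space $X$, $C(X;\mathbb{R})$ is the algebra of all real-valued continuous functions on $X$. A one-codimensional ideal of an algebra is an ideal of codimension one as a linear subspace. For $p\in X$ put $p^*=\{f\in C(X;\mathbb{R}): f(p)=0\}$. A completely regular topological space $X$ is called realcompact if every one-codimensional ideal of $C(X;\mathbb{R})$ is of the form $p^*$ for some $p\in X$. A $\{0,1\}$-valued $\sigma$-measure on a set $X$ is a countably additive function $\mu$ defined on the family of all subsets of $X$ and assuming only the values $0$ and $1$. It is called free if $\mu(\{x\})=0$ for all $x\in X$, and trivial if $\mu\equiv 0$. A cardinal $\mathfrak{m}$ is called $\sigma$-measurable if a set $X$ of cardinality $\mathfrak{m}$ admits a $\{0,1\}$-valued $\sigma$-measure which is free and nontrivial. *)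

(* Defs.v *)
From HB Require Import structures.
From mathcomp Require Import all_boot all_order all_algebra.
From mathcomp Require Import all_classical all_reals all_analysis.

Set Implicit Arguments.
Unset Strict Implicit.
Unset Printing Implicit Defensive.

Import Order.TTheory GRing.Theory Num.Theory.
Import numFieldNormedType.Exports.

Local Open Scope classical_set_scope.
Local Open Scope ring_scope.

Definition iter_partial (R : realType) (m n : nat) (s : seq 'I_m)
    (f : 'rV[R]_m -> 'rV[R]_n) : 'rV[R]_m -> 'rV[R]_n :=
  foldr (fun i g x => 'D_(delta_mx 0 i) g x) f s.

(* Meant for open [U]: all partial derivatives of all orders exist and are
   continuous at the points of [U].  As [U] is open, this does not depend on
   the values of the total function [f] outside [U]. *)
Definition smooth_on (R : realType) (m n : nat) (U : set 'rV[R]_m)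
    (f : 'rV[R]_m -> 'rV[R]_n) : Prop :=
  forall (s : seq 'I_m) (x : 'rV[R]_m), U x ->
    {for x, continuous (iter_partial s f)} /\
    forall i : 'I_m, derivable (iter_partial s f) x (delta_mx 0 i).

(* A homeomorphism from an open subset of [M] onto an open subset of
   [R^chart_dim].  [chart_map] and [chart_inv] are total functions of which
   only the restrictions to [chart_dom] and to its image matter.  The dimension
   belongs to the chart, so different components of a manifold may have
   different dimensions. *)
Record chart (R : realType) (M : topologicalType) : Type := Chart {
  chart_dim : nat;
  chart_dom : set M;
  chart_map : M -> 'rV[R]_chart_dim;
  chart_inv : 'rV[R]_chart_dim -> M;
  chart_dom_open : open chart_dom;
  chart_im_open : open (chart_map @` chart_dom);
  chart_mapK : forall x, chart_dom x -> chart_inv (chart_map x) = x;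
  chart_map_cont : {within chart_dom, continuous chart_map};
  chart_inv_cont : {within chart_map @` chart_dom, continuous chart_inv}
}.

Arguments chart_dim {R M} c.
Arguments chart_dom {R M} c.
Arguments chart_map {R M} c.
Arguments chart_inv {R M} c.

Definition smooth_transition (R : realType) (M : topologicalType)
    (c d : chart R M) : Prop :=
  smooth_on (chart_map c @` (chart_dom c `&` chart_dom d))
            (chart_map d \o chart_inv c).

Definition smooth_atlas (R : realType) (M : topologicalType)
    (A : set (chart R M)) : Prop :=
  \bigcup_(c in A) chart_dom c = [set: M] /\
  forall c d, A c -> A d -> smooth_transition c d.

Definition open_covering (T : topologicalType) (U : set (set T)) : Prop :=
  (forall B, U B -> open B) /\ \bigcup_(B in U) B = [set: T].

Definition locally_finite (T : topologicalType) (V : set (set T)) : Prop :=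
  forall x : T, exists2 W, nbhs x W &
    finite_set [set B | V B /\ B `&` W !=set0].

Definition paracompact (T : topologicalType) : Prop :=
  forall U : set (set T), open_covering U ->
    exists V : set (set T),
      [/\ open_covering V,
          forall B, V B -> exists2 A, U A & B `<=` A &
          locally_finite V].

(* The algebra C(X; R), as a subset of the algebra of all functions. *)
Definition cfun (R : realType) (X : topologicalType) : set (X -> R) :=
  [set f | continuous f].

Arguments cfun R X : clear implicits.

Definition cfun_ideal (R : realType) (X : topologicalType)
    (I : set (X -> R)) : Prop :=
  [/\ I `<=` cfun R X,
      I 0,
      forall f g, I f -> I g -> I (f + g),
      forall (c : R) f, I f -> I (c *: f) &
      forall f g, cfun R X f -> I g -> I (f * g)].

(* The quotient C(X; R) / I has a basis with a single element, the class of
   [e]. *)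
Definition codim1 (R : realType) (X : topologicalType)
    (I : set (X -> R)) : Prop :=
  exists e : X -> R, [/\ cfun R X e, ~ I e &
    forall f, cfun R X f -> exists c : R, I (f - c *: e)].

Definition vanishing_ideal (R : realType) (X : topologicalType) (p : X) :
    set (X -> R) :=
  [set f | cfun R X f /\ f p = 0].

Arguments vanishing_ideal R {X} p.

Definition realcompact (R : realType) (X : topologicalType) : Prop :=
  completely_regular_space X /\
  forall I : set (X -> R), cfun_ideal I -> codim1 I ->
    exists p : X, I = vanishing_ideal R p.

(* Countable additivity forces [mu set0 = 0], since the constant sequence
   [set0] is disjoint. *)
Definition zero_one_sigma_measure (R : realType) (X : Type)
    (mu : set X -> R) : Prop :=
  (forall A, mu A = 0 \/ mu A = 1) /\
  forall F : (set X)^nat, trivIset [set: nat] F ->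
    (fun n => \sum_(0 <= i < n) mu (F i)) @ \oo --> mu (\bigcup_n F n).

Definition free_measure (R : realType) (X : Type) (mu : set X -> R) : Prop :=
  forall x : X, mu [set x] = 0.

Definition trivial_measure (R : realType) (X : Type) (mu : set X -> R) : Prop :=
  forall A : set X, mu A = 0.

(* The cardinal is that of the set [K]: there are no cardinal numbers as
   objects, and [#=] is equipotence. *)
Definition sigma_measurable_card (R : realType) (T : Type) (K : set T) : Prop :=
  exists X : Type, ([set: X] #= K)%card /\
    exists mu : set X -> R,
      [/\ zero_one_sigma_measure mu, free_measure mu & ~ trivial_measure mu].

Definition components (T : topologicalType) : set (set T) :=
  range (connected_component [set: T]).

Arguments components T : clear implicits.

(* Main.v *)
Require Import Defs.
From HB Require Import structures.
From mathcomp Require Import all_boot all_order all_algebra.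
From mathcomp Require Import all_classical all_reals all_analysis.
From mathcomp Require Import ring lra.

(** A [{0,1}]-valued sigma-measure is the same thing as a sigma-ideal of null
    sets that contains every set or its complement, and so is a
    one-codimensional ideal [I] of the continuous functions as far as clopen
    sets are concerned: call a set null for [I] when some member of [I] has no
    zero on it. Both directions of the theorem compare these two notions on the
    set of connected components, every union of which is clopen because the
    manifold is locally connected.

    If the components carry a free nontrivial measure, pick a point in each
    component. The continuous functions that vanish at almost all the chosen
    points form a one-codimensional ideal, since a real function on a set with
    a [{0,1}]-valued sigma-measure is constant almost everywhere
    ([sigma_ideal_ae_constant]). The ideal is not that of a point [p]: the
    indicator of the component of [p] belongs to it, a single component being
    negligible.

    Conversely let [I] be a one-codimensional ideal and suppose that no point
    is a common zero of [I]. Then every point has a null neighborhood. The null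
    sets of [I] form a sigma-ideal ([ideal_null_sigma]), because [I] is closed
    under sums of suitably scaled series of its nonnegative members. A component
    of a paracompact locally compact space is covered by countably many compact
    sets, hence it is null ([paracompact_component_ideal]). A set of components
    being negligible when its union is null therefore defines a free measure on
    the set of components, nontrivial because a member of [I] must have a zero.
    So if the number of components is not sigma-measurable, [I] has a common
    zero [p] and, by codimension one, [I] is the ideal of [p].

    Charts provide every point with a compact connected neighborhood, which
    makes the components open and the manifold completely regular. *)

Set Implicit Arguments.
Unset Strict Implicit.
Unset Printing Implicit Defensive.

Import Order.TTheory GRing.Theory Num.Theory.
Import numFieldNormedType.Exports.

Local Open Scope classical_set_scope.
Local Open Scope ring_scope.

(** * Ideals of sets and two-valued measures *)

Record set_ideal (T : Type) (N : set T -> Prop) : Prop := SetIdeal {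
  set_ideal0 : N set0;
  set_idealS : forall A B, A `<=` B -> N B -> N A;
  set_idealU : forall A B, N A -> N B -> N (A `|` B)
}.

Record sigma_ideal (T : Type) (N : set T -> Prop) : Prop := SigmaIdeal {
  sigma_ideal0 : N set0;
  sigma_idealS : forall A B, A `<=` B -> N B -> N A;
  sigma_ideal_bigcup : forall F : (set T)^nat,
    (forall n, N (F n)) -> N (\bigcup_n F n)
}.

(** For a proper sigma-ideal this makes the complements of its members a
    countably complete ultrafilter. *)
Definition prime_ideal (T : Type) (N : set T -> Prop) : Prop :=
  forall A, N A \/ N (~` A).

Lemma sigma_ideal_set_ideal (T : Type) (N : set T -> Prop) :
  sigma_ideal N -> set_ideal N.
Proof.
move=> [N0 NS Nbig]; split=> // A B NA NB; rewrite -bigcup2E.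
by apply: Nbig => -[|[|n]].
Qed.

Lemma set_ideal_bigcup_finite (T : Type) (I : choiceType) (N : set T -> Prop)
    (D : set I) (F : I -> set T) :
  set_ideal N -> finite_set D -> (forall i, D i -> N (F i)) ->
  N (\bigcup_(i in D) F i).
Proof.
move=> [N0 NS NU] /finite_fsetP[X ->] NF; rewrite bigcup_fset big_seq.
by apply: big_ind => // i iX; exact: NF.
Qed.

(** The constant is the supremum of the [t] such that [g >= t] almost
    everywhere; countable unions reach the two open half-lines around it. *)
Lemma sigma_ideal_ae_constant (R : realType) (T : Type) (N : set T -> Prop)
    (g : T -> R) :
  sigma_ideal N -> prime_ideal N -> exists c, N [set x | g x != c].
Proof.
move=> sN pN; have [N0 NS NU] := sigma_ideal_set_ideal sN.
have [NT|nNT] := pselect (N setT); first by exists 0; exact: NS NT.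
have nNC A : N A -> ~ N (~` A).
  by move=> NA NC; apply: nNT; rewrite -(setUv A); exact: NU.
pose S := [set t | N [set x | g x < t]].
(* [S] is nonempty and bounded above as no real is below every [- n] or
   above every [n]. *)
have S0 : S !=set0.
  apply: contrapT => /forallNP S0; apply: nNT.
  apply: (@NS _ (\bigcup_n [set x | - n%:R <= g x])).
    move=> x _; exists (Num.bound `|g x|) => //=.
    rewrite lerNl (le_trans (ler_norm _))// normrN ltW//.
    exact: archi_boundP.
  apply: (sigma_ideal_bigcup sN) => n.
  have [/S0//|] := pN [set x | g x < - n%:R].
  by apply: NS => x /= /le_gtF ->.
have NSlt t u : t <= u -> S u -> S t.
  by move=> tu; apply: NS => x /= /lt_le_trans; exact.
have [n nSn] : exists n : nat, ~ S n%:R.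
  apply: contrapT => /forallNP Sn; apply: nNT.
  apply: (@NS _ (\bigcup_n [set x | g x < n%:R])).
    move=> x _; exists (Num.bound `|g x|) => //=.
    by rewrite (le_lt_trans (ler_norm _))// archi_boundP.
  by apply: (sigma_ideal_bigcup sN) => n; exact: contrapT (Sn n).
have ubS : has_ubound S.
  exists n%:R => t St; rewrite leNgt; apply/negP => /ltW nt.
  exact: nSn (NSlt _ _ nt St).
(* [g < sup S] and [g > sup S] are countable unions of sets cut out at a
   distance [1/(k+1)] from [sup S]. *)
exists (sup S).
apply: (@NS _ ([set x | g x < sup S] `|` [set x | sup S < g x])).
  by move=> x /=; case: ltgtP => // ? _; [left|right].
apply: NU.
  apply: (@NS _ (\bigcup_n [set x | g x < sup S - n.+1%:R^-1])).
    move=> x /= xS; have /ltr_add_invr[k xk] := xS.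
    by exists k => //=; rewrite ltrBrDr.
  apply: (sigma_ideal_bigcup sN) => k.
  have [t St kt] : exists2 t, S t & sup S - k.+1%:R^-1 < t.
    by apply: sup_adherent => //; rewrite invr_gt0.
  exact: NSlt (ltW kt) St.
apply: (@NS _ (\bigcup_n [set x | sup S + n.+1%:R^-1 <= g x])).
  by move=> x /= /ltr_add_invr[k xk]; exists k => //=; exact: ltW.
apply: (sigma_ideal_bigcup sN) => k.
have [Sk|] := pN [set x | g x < sup S + k.+1%:R^-1].
  have := ub_le_sup ubS Sk.
  by rewrite leNgt ltrDl invr_gt0 ltr0n.
by apply: NS => x /= /le_gtF ->.
Qed.

(** Everything comes from comparing a partial sum with its limit, which is at
    most 1: two disjoint sets cannot both have measure 1. *)
Lemma zero_one_sigma_measureP (R : realType) (T : Type) (mu : set T -> R) :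
  zero_one_sigma_measure mu ->
  sigma_ideal (fun A => mu A = 0) /\ prime_ideal (fun A => mu A = 0).
Proof.
move=> [mu01 muU].
have mu0 A : 0 <= mu A by case: (mu01 A) => ->.
have mu1 A : mu A <= 1 by case: (mu01 A) => ->.
have sum_le (F : (set T)^nat) n : trivIset setT F ->
    \sum_(0 <= i < n) mu (F i) <= mu (\bigcup_n F n).
  move=> tF; have cF := muU _ tF; rewrite -(cvg_lim (@Rhausdorff R) cF).
  apply: nondecreasing_cvgn_le; last by apply/cvg_ex; eexists; exact: cF.
  by apply/nondecreasing_series => i _ _; exact: mu0.
have mu_set0 : mu set0 = 0.
  have [//|mu_1] := mu01 set0.
  have := sum_le (fun=> set0) 2%N; rewrite big_nat_recr//= big_nat1 mu_1.
  have t0 : trivIset [set: nat] (fun=> @set0 T) by move=> i j _ _ [x []].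
  by move=> /(_ t0) /le_trans/(_ (mu1 _)); rewrite gerDl ler10.
have add_le A B : A `&` B = set0 -> mu A + mu B <= mu (A `|` B).
  move=> AB0; rewrite -bigcup2E.
  have := sum_le (bigcup2 A B) 2%N; rewrite big_nat_recr//= big_nat1.
  by apply; rewrite -trivIset_bigcup2.
have muS A B : A `<=` B -> mu B = 0 -> mu A = 0.
  move=> AB muB; have := add_le A (B `\` A) (setDIK _ _).
  rewrite setDUK// muB => ABle0; apply/eqP; rewrite eq_le mu0 andbT.
  by rewrite (le_trans _ ABle0)// lerDl.
split; last first.
  move=> A; have [->|A1] := mu01 A; first by left.
  have [->|C1] := mu01 (~` A); first by right.
  have := add_le A (~` A) (setICr _); rewrite A1 C1 => /le_trans/(_ (mu1 _)).
  by rewrite gerDl ler10.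
split => // F F0; rewrite seqDU_bigcup_eq.
have sum0 n : \sum_(0 <= i < n) mu (seqDU F i) = 0.
  by rewrite big1 // => i _; exact: muS (@subset_seqDU _ F i) (F0 i).
have := muU _ (trivIset_seqDU F); under eq_fun do rewrite sum0.
by move=> /(cvg_lim (@Rhausdorff R)) <-; rewrite lim_cst//; exact: Rhausdorff.
Qed.

Definition ideal_measure (R : realType) (T : Type) (N : set T -> Prop)
  (A : set T) : R := if pselect (N A) then 0 else 1.

(** At most one set of a disjoint sequence is not in [N], so the partial sums
    are eventually constant. *)
Lemma ideal_measure_zero_one (R : realType) (T : Type) (N : set T -> Prop) :
  sigma_ideal N -> prime_ideal N -> zero_one_sigma_measure (@ideal_measure R T N).
Proof.
move=> sN pN; have [N0 NS NU] := sigma_ideal_set_ideal sN.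
split=> [A|F tF]; first by rewrite /ideal_measure; case: pselect; [left|right].
have muN A : N A -> @ideal_measure R T N A = 0.
  by rewrite /ideal_measure; case: pselect.
have mun A : ~ N A -> @ideal_measure R T N A = 1.
  by rewrite /ideal_measure; case: pselect.
have [NF|/existsNP[k Fk]] := pselect (forall n, N (F n)).
  rewrite (muN _ (sigma_ideal_bigcup sN NF)).
  have sum0 n : \sum_(0 <= i < n) @ideal_measure R T N (F i) = 0.
    by rewrite big1 // => i _; exact: muN.
  by under eq_fun do rewrite sum0; exact: cvg_cst.
rewrite (mun (\bigcup_n F n)); last first.
  by move=> NU'; apply: Fk; apply: NS NU'; exact: bigcup_sup.
apply: cvg_near_cst; exists k.+1 => // n /= kn.
rewrite (bigD1_seq k)/= ?mem_index_iota ?iota_uniq// mun//.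
rewrite big1 ?addr0// => i ik; apply: muN.
have [//|] := pN (F k); apply: NS => x Fix Fkx.
by move/eqP: ik; apply; apply: (tF i k) => //; exists x.
Qed.

(** * Paracompact spaces *)

(** Otherwise the sets whose complement in [K] belongs to [N] form a proper
    filter; at a cluster point of it, a neighborhood in [N] would meet its own
    complement. *)
Lemma compact_set_ideal (T : topologicalType) (N : set T -> Prop) (K : set T) :
  set_ideal N -> compact K -> (forall x, K x -> exists2 W, nbhs x W & N W) ->
  N K.
Proof.
move=> [N0 NS NU] cK locN; apply: contrapT => nNK.
pose F := [set A | N (K `\` A)].
have FF : ProperFilter F.
  split; first by rewrite /F /= setD0.
  split; first by rewrite /F /= setDT.
    by move=> A B FA FB; rewrite /F /= setDIr; exact: NU.
  by move=> A B AB; apply: NS => x [Kx Bx]; split => // /AB.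
have FK : F K by rewrite /F /= setDv.
have [x [Kx clx]] := cK F FF FK.
have [W xW NW] := locN x Kx.
have FW : F (~` W) by apply: NS NW => y [_ /contrapT].
by have [y []] := clx _ _ FW xW.
Qed.

Lemma locally_finite_compact (T : topologicalType) (V : set (set T))
    (K : set T) :
  locally_finite V -> compact K -> finite_set [set B | V B /\ B `&` K !=set0].
Proof.
move=> lfV cK.
apply: (@compact_set_ideal _ (fun A => finite_set [set B | V B /\ B `&` A !=set0])
  _ _ cK); last by move=> x _; exact: lfV.
split=> [|A B AB fB|A B fA fB].
- by apply: sub_finite_set (finite_set0 _) => B [_ [x []]].
- apply: sub_finite_set fB => C [VC [x [Cx /AB Bx]]].
  by split => //; exists x.
- have : finite_set ([set C | V C /\ C `&` A !=set0] `|`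
                     [set C | V C /\ C `&` B !=set0]) by rewrite finite_setU.
  apply: sub_finite_set => C [VC [x [Cx [Ax|Bx]]]]; [left|right];
  by split => //; exists x.
Qed.

Lemma connected_component_sub_clopen (T : topologicalType) (O : set T) (x : T) :
  clopen O -> O x -> connected_component setT x `<=` O.
Proof.
move=> [oO cO] Ox; apply/setIidPl.
apply: (@component_connected _ setT x (connected_component setT x `&` O)).
- by exists x; split => //; exact: connected_component_refl.
- by exists O.
- by exists O.
Qed.

(** Refine the cover by the relatively compact open sets to a locally finite
    [V]. Each member of [V] meets only finitely many others, so the sets reached
    from [x] by chains of overlapping members of [V] are countably many; their
    union is clopen, as a member of [V] that meets it lies in it. *)
Lemma paracompact_component_ideal (T : topologicalType) (N : set T -> Prop) :
  paracompact T -> (forall x : T, exists2 K, nbhs x K & compact K) ->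
  sigma_ideal N -> (forall x : T, exists2 W, nbhs x W & N W) ->
  forall x, N (connected_component setT x).
Proof.
move=> pT lcT sN locN x.
have iN := sigma_ideal_set_ideal sN; have [N0 NS NU] := iN.
have [|V [[oV cV] VU lfV]] :=
    pT [set A | open A /\ exists2 K, compact K & A `<=` K].
  split=> [A []//|]; rewrite -subTset => y _.
  have [K yK cK] := lcT y; exists K°; last exact: yK.
  by split; [exact: open_interior|exists K => //; exact: interior_subset].
pose meets A := [set B | V B /\ B `&` A !=set0].
have fin_meets A K : compact K -> A `<=` K -> finite_set (meets A).
  move=> cK AK; apply: sub_finite_set (locally_finite_compact lfV cK).
  by move=> B [VB [y [By /AK Ky]]]; split => //; exists y.
pose reach := fix reach n :=
  if n is m.+1 then \bigcup_(B in reach m) meets B else meets [set x].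
have reachV n B : reach n B -> V B.
  by case: n => [[]//|n /= [C _ []]].
have fin_reach n : finite_set (reach n).
  elim: n => [|n IHn] /=; first exact: (fin_meets _ _ (@compact_set1 _ x)).
  apply: bigcup_finite => // B /reachV/VU[A [_ [K cK AK]] BA].
  exact: fin_meets cK (subset_trans BA AK).
pose O := \bigcup_n \bigcup_(B in reach n) B.
have coverV y : exists2 B, V B & B y.
  by have : [set: T] y by []; rewrite -cV => -[B VB By]; exists B.
have oO : open O.
  by apply: bigcup_open => n _; apply: bigcup_open => B /reachV/oV.
have cO : closed O.
  rewrite -openC openE => y nOy; have [B VB By] := coverV y.
  apply: filterS (open_nbhs_nbhs (conj (oV _ VB) By)) => z Bz [n _ [C rC Cz]].
  apply: nOy; exists n.+1 => //; exists B => //; exists C => //; split=> //.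
  by exists z.
have Ox : O x.
  have [B VB Bx] := coverV x; exists 0%N => //; exists B => //=; split => //.
  by exists x.
apply: (NS _ O); first exact: connected_component_sub_clopen.
apply: (sigma_ideal_bigcup sN) => n.
apply: set_ideal_bigcup_finite => // B /reachV/VU[A [_ [K cK AK]] BA].
apply: (NS _ K); first exact: subset_trans BA AK.
exact: compact_set_ideal.
Qed.

(** * Components of locally connected spaces *)

(** The complement of a union of components is again one, so openness is
    enough. *)
Lemma clopen_saturated (T : topologicalType) (A : set T) :
  (forall x : T, exists2 W, nbhs x W & connected W) ->
  (forall x, A x -> connected_component setT x `<=` A) -> clopen A.
Proof.
move=> lcT.
have oS (B : set T) :
    (forall x, B x -> connected_component setT x `<=` B) -> open B.
  move=> satB; rewrite openE => x Bx; have [W xW cW] := lcT x.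
  apply: filterS (xW) => y Wy; apply: (satB x Bx).
  exists W => //; split=> //; exact: nbhs_singleton.
move=> satA; split; first exact: oS.
rewrite -openC; apply: oS => x nAx y xy Ay; apply: nAx.
by apply: (satA y Ay); exact: connected_component_sym.
Qed.

Lemma continuous_indic_clopen (R : realType) (T : topologicalType)
    (A : set T) : clopen A -> continuous (\1_A : T -> R).
Proof.
move=> [oA cA] x; have [Ax|nAx] := pselect (A x).
  apply: (near_cst_continuous (1 : R)).
  apply: filterS (open_nbhs_nbhs (conj oA Ax)) => y Ay.
  by rewrite indicE mem_set.
apply: (near_cst_continuous (0 : R)).
have oC : open (~` A) by rewrite openC.
apply: filterS (open_nbhs_nbhs (conj oC nAx)) => y Ay.
by rewrite indicE memNset.
Qed.

(** * Charts *)

Lemma closed_ball_connected (R : realType) (n : nat) (x : 'rV[R]_n)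
    (r : R) : 0 < r -> connected (closed_ball x r).
Proof.
move=> r0; rewrite closed_ballE//.
(* The ball is a union of segments issued from its center. *)
pose seg (y : 'rV[R]_n) := (fun t : R => x + t *: (y - x)) @` `[0, 1]%classic.
rewrite (_ : closed_ball_ _ _ _ =
    \bigcup_(y in [set y | `|x - y| <= r]) seg y); last first.
  apply/seteqP; split=> [y /= xy|z [y /= xy [t /=]]].
    exists y => //; exists 1; first by rewrite /= in_itv/= ler01 lexx.
    by rewrite scale1r addrC subrK.
  rewrite in_itv/= => /andP[t0 t1] <-; rewrite /closed_ball_ /=.
  rewrite opprD addrA subrr sub0r normrN normrZ ger0_norm//.
  by rewrite (le_trans _ xy)// distrC ler_piMl.
apply: bigcup_connected.
  exists x => y _; exists 0; first by rewrite /= in_itv/= ler01 lexx.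
  by rewrite scale0r addr0.
move=> y _; apply: connected_continuous_connected.
  exact: segment_connected.
apply: continuous_subspaceT => t; apply: cvgD; first exact: cvg_cst.
apply: cvgZr_tmp; exact: cvg_id.
Qed.

(** Small closed balls around the image of [x] are compact and connected, and
    [chart_inv] carries them back to neighborhoods of [x]. *)
Lemma chart_compact_connected_nbhs (R : realType) (M : topologicalType)
    (c : chart R M) (x : M) : chart_dom c x ->
  exists K, [/\ nbhs x K, compact K & connected K].
Proof.
move=> cx.
have ix : (chart_map c @` chart_dom c) (chart_map c x) by exists x.
have /nbhs_closedballP[r rI] : nbhs (chart_map c x) (chart_map c @` chart_dom c).
  exact: open_nbhs_nbhs (conj (@chart_im_open _ _ c) ix).
have cB : {within closed_ball (chart_map c x) r%:num, continuous chart_inv c}.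
  exact: continuous_subspaceW rI (@chart_inv_cont _ _ c).
exists (chart_inv c @` closed_ball (chart_map c x) r%:num); split.
- have xD : nbhs x (chart_dom c).
    exact: open_nbhs_nbhs (conj (@chart_dom_open _ _ c) cx).
  have : {for x, continuous (chart_map c)}.
    have := @chart_map_cont _ _ c.
    by rewrite continuous_open_subspace; [apply; rewrite inE|exact: chart_dom_open].
  move=> /(_ (closed_ball (chart_map c x) r%:num)) cc.
  have xB : nbhs x (chart_map c @^-1` closed_ball (chart_map c x) r%:num).
    by apply: cc; apply/nbhs_closedballP; exists r.
  apply: filterS (filterI xD xB) => y [Dy By].
  by exists (chart_map c y) => //; exact: chart_mapK.
- apply: continuous_compact => //; apply: bounded_closed_compact.
    exists (`|chart_map c x| + r%:num); split; first exact: num_real.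
    move=> b xrb y; rewrite closed_ballE// /closed_ball_ /= => xy.
    rewrite (le_trans _ (ltW xrb))// -[y](subKr (chart_map c x)).
    by rewrite (le_trans (ler_normB _ _))// lerD2l.
  exact: closed_ball_closed.
- apply: connected_continuous_connected => //; exact: closed_ball_connected.
Qed.

(** * One-codimensional ideals of continuous functions *)

(** The function need not be bounded away from zero on [A]: this is what lets
    countable unions of null sets be null. *)
Definition ideal_null (R : realType) (X : topologicalType) (I : set (X -> R))
    (A : set X) : Prop :=
  exists2 f, I f & forall x, A x -> f x != 0.

(** A nowhere vanishing continuous function is invertible. *)
Lemma codim1_proper (R : realType) (X : topologicalType) (I : set (X -> R)) :
  cfun_ideal I -> codim1 I -> ~ ideal_null I setT.
Proof.
move=> [Icts _ _ _ IM] [e [ce Ie _]] [f If f0]; apply: Ie.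
have -> : e = (e * (fun x => (f x)^-1)) * f.
  by apply/funext => x; rewrite !fctE mulfVK// f0.
apply: IM (If) => x; apply: cvgM; first exact: ce.
by apply: cvgV; [exact: f0|exact: Icts].
Qed.

(** The number [c] is the value at [f] of the character with kernel [I]. *)
Lemma codim1_value (R : realType) (X : topologicalType) (I : set (X -> R))
    (f : X -> R) :
  cfun_ideal I -> codim1 I -> continuous f -> exists c, I (fun x => f x - c).
Proof.
move=> iI dI cf; have nI := codim1_proper iI dI.
have [_ _ ID IZ _] := iI; have [e [ce _ Ie]] := dI.
have [a Ia] := Ie (fun=> 1) (fun x => cvg_cst _).
have [b Ib] := Ie f cf.
have a0 : a != 0.
  apply/eqP => a0; apply: nI; exists (fun=> 1); last by move=> x _; exact: oner_neq0.
  by move: Ia; rewrite a0 scale0r subr0.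
exists (b / a).
rewrite (_ : (fun x => _) = (f - b *: e) + (- (b / a)) *: ((fun=> 1) - a *: e)).
  by apply: ID => //; exact: IZ.
apply/funext => x; rewrite !fctE; rewrite /GRing.scale /=.
by field.
Qed.

Lemma ideal_null_set_ideal (R : realType) (X : topologicalType) (I : set (X -> R)) :
  cfun_ideal I -> set_ideal (ideal_null I).
Proof.
move=> [Icts I0 ID _ IM]; split=> [|A B AB [f If f0]|A B [f If f0] [g Ig g0]].
- by exists 0.
- by exists f => // x /AB/f0.
- exists (f * f + g * g); first by apply: ID; apply: IM => //; exact: Icts.
  move=> x ABx; rewrite !fctE -!expr2 paddr_eq0 ?sqr_ge0// !sqrf_eq0.
  by case: ABx => [/f0|/g0] /negPf ->; rewrite ?andbF.
Qed.

(** The indicator of [A] differs from its value [c] under the character on all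
    of [A] unless [c = 1], and on all of the complement unless [c = 0]. *)
Lemma ideal_null_prime (R : realType) (X : topologicalType) (I : set (X -> R))
    (A : set X) :
  cfun_ideal I -> codim1 I -> clopen A -> ideal_null I A \/ ideal_null I (~` A).
Proof.
move=> iI dI clA.
have [c Ic] := codim1_value iI dI (@continuous_indic_clopen R _ _ clA).
have [c1|c1] := eqVneq c 1; [right|left]; eexists; try exact: Ic => //.
- by move=> x nAx; rewrite /= indicE memNset// c1 sub0r oppr_eq0 oner_neq0.
- by move=> x Ax; rewrite /= indicE mem_set// subr_eq0 eq_sym.
Qed.

Lemma continuous_uniform_approx (R : realType) (X : topologicalType)
    (g : X -> R) :
  (forall e, 0 < e -> exists2 f : X -> R, continuous f &
    forall x, `|g x - f x| <= e) ->
  continuous g.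
Proof.
move=> gf x; apply/cvgrPdist_lt => e e0.
have e4 : 0 < e / 4 by rewrite divr_gt0.
have [f cf fg] := gf _ e4.
have /cvgrPdist_lt/(_ _ e4) := cf x.
apply: filterS => y /= fxy.
have -> : g x - g y = (g x - f x) + (f x - f y) - (g y - f y) by ring.
rewrite (le_lt_trans (ler_normB _ _))//.
have := fg y; have := ler_normD (g x - f x) (f x - f y); have := fg x.
by lra.
Qed.

(** If [f n] in [I] has no zero on [F n], then
    [g = \sum_n 2^-(n+1) * f n ^ 2 / (1 + f n ^ 2)] is continuous and positive
    on all [F n]. Its partial sums [S n] are in [I], and [g] belongs to [I] as
    well: if it had a value [c != 0] under the character with kernel [I], then
    [g - c] and a partial sum with [`|g - S n| < `|c|] would be members of [I]
    without a common zero. *)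
Lemma ideal_null_sigma (R : realType) (X : topologicalType) (I : set (X -> R)) :
  cfun_ideal I -> codim1 I -> sigma_ideal (ideal_null I).
Proof.
move=> iI dI; have [N0 NS NU] := ideal_null_set_ideal iI.
split=> // F NF.
have /choice[f fP] n : exists f, I f /\ forall x, F n x -> f x != 0.
  by have [f If f0] := NF n; exists f.
have If n : I (f n) by have [] := fP n.
have f0 n x : F n x -> f n x != 0 by have [_] := fP n; exact.
have [Icts I0 ID IZ IM] := iI.
pose h n x : R := 2^-1 ^+ n.+1 * (f n x ^+ 2 / (1 + f n x ^+ 2)).
have d0 n x : 0 < 1 + f n x ^+ 2 by rewrite ltr_pwDl// sqr_ge0.
have h_ge0 n x : 0 <= h n x.
  by rewrite mulr_ge0 ?exprn_ge0 ?invr_ge0// divr_ge0 ?sqr_ge0// ltW.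
have h_le n x : h n x <= 2^-1 ^+ n.+1.
  rewrite ler_piMr ?exprn_ge0 ?invr_ge0// ler_pdivrMr// mul1r.
  by rewrite lerDr.
have Ih n : I (h n).
  rewrite (_ : h n =
      (2^-1 ^+ n.+1 *: (f n * (fun x => (1 + f n x ^+ 2)^-1))) * f n); last first.
    by apply/funext => x; rewrite /h !fctE /GRing.scale /=; field; exact: lt0r_neq0.
  apply: IM (If n) => x; apply: cvgZl_tmp; apply: cvgM; first exact: Icts.
  apply: cvgV; first exact: lt0r_neq0.
  by apply: cvgD; [exact: cvg_cst|apply: cvgM; exact: Icts].
pose S n x : R := \sum_(0 <= i < n) h i x.
have IS n : I (S n).
  elim: n => [|n IHn].
    by rewrite (_ : S 0%N = 0)//; apply/funext => x; rewrite /S big_geq.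
  rewrite (_ : S n.+1 = S n + h n); first exact: ID.
  by apply/funext => x; rewrite /S big_nat_recr.
have ndS x : nondecreasing_seq (S ^~ x).
  by apply/nondecreasing_seqP => n; rewrite /S big_nat_recr//= lerDl.
have niS x : nonincreasing_seq (fun n => S n x + 2^-1 ^+ n).
  apply/nonincreasing_seqP => n; rewrite /S big_nat_recr//= -addrA lerD2l.
  by have := h_le n x; rewrite exprS; lra.
(* As the partial sums increase, their limit is their supremum. *)
pose g x := sup (range (S ^~ x)).
have SleS m n x : S m x <= S n x + 2^-1 ^+ n.
  have e0 k : 0 <= 2^-1 ^+ k :> R by rewrite exprn_ge0 ?invr_ge0.
  have [mn|/ltnW nm] := leqP m n.
    by rewrite (le_trans (ndS x _ _ mn))// lerDl.
  by rewrite (le_trans _ (niS x _ _ nm))// lerDl.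
have g_ge n x : S n x <= g x.
  apply: ub_le_sup; last by exists n.
  by exists (S 0%N x + 2^-1 ^+ 0) => _ [m _ <-].
have g_le n x : g x <= S n x + 2^-1 ^+ n.
  apply: ge_sup; first by exists (S 0%N x); exists 0%N.
  by move=> _ [m _ <-].
have gS n x : `|g x - S n x| <= 2^-1 ^+ n.
  by rewrite ger0_norm ?subr_ge0// lerBlDl.
have small (e : R) : 0 < e -> exists n, 2^-1 ^+ n < e.
  move=> e0; have [n _ ne] := near_infty_natSinv_expn_lt (PosNum e0).
  by exists n; rewrite exprVn -div1r; apply: ne => /=.
have cg : continuous g.
  apply: continuous_uniform_approx => e /small[n /ltW ne].
  exists (S n); first exact: Icts.
  by move=> x; rewrite (le_trans (gS n x)).
have [c Ic] := codim1_value iI dI cg.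
have c0 : c = 0.
  apply/eqP; apply: contrapT => /negP c0; apply: (codim1_proper iI dI).
  have [n nc] : exists n, 2^-1 ^+ n < `|c| by apply: small; rewrite normr_gt0.
  apply: (@NS _ ([set x | g x - c != 0] `|` [set x | S n x != 0])).
    move=> x _; apply: contrapT => /not_orP[/negP/negPn/eqP gc /negP/negPn/eqP Sn0].
    by have := gS n x; move/subr0_eq : gc => ->; rewrite Sn0 subr0 leNgt nc.
  by apply: NU; [exists (fun x => g x - c)|exists (S n)].
exists g.
  by move: Ic; rewrite c0; under eq_fun do rewrite subr0.
move=> x [n _ Fx]; rewrite gt_eqF// (lt_le_trans _ (g_ge n.+1 x))//.
rewrite /S big_nat_recr//= ltr_wpDl ?sumr_ge0//.
rewrite mulr_gt0 ?exprn_gt0 ?invr_gt0// divr_gt0//.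
by rewrite lt_def sqr_ge0 sqrf_eq0 f0.
Qed.

(** Evaluation at [p] is a character that kills [I], so it is the one with
    kernel [I]. *)
Lemma codim1_fixed (R : realType) (X : topologicalType) (I : set (X -> R))
    (p : X) :
  cfun_ideal I -> codim1 I -> (forall f, I f -> f p = 0) ->
  I = vanishing_ideal R p.
Proof.
move=> iI dI Ip; apply/seteqP; split=> [f If|f [cf fp]].
  by split; [case: iI => Icts *; exact: Icts|exact: Ip].
have [c Ic] := codim1_value iI dI cf.
have c0 : c = 0 by have /eqP := Ip _ Ic; rewrite fp sub0r oppr_eq0 => /eqP.
by move: Ic; rewrite c0; under eq_fun do rewrite subr0.
Qed.

Definition ae_vanishing_ideal (R : realType) (X : topologicalType) (T : Type)
    (N : set T -> Prop) (pt : T -> X) : set (X -> R) :=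
  [set f | continuous f /\ N [set t | f (pt t) != 0]].

(** The character is the almost everywhere constant value of [f \o pt]. *)
Lemma ae_vanishing_idealP (R : realType) (X : topologicalType) (T : Type)
    (N : set T -> Prop) (pt : T -> X) :
  sigma_ideal N -> prime_ideal N -> ~ N setT ->
  cfun_ideal (@ae_vanishing_ideal R X T N pt) /\
  codim1 (@ae_vanishing_ideal R X T N pt).
Proof.
move=> sN pN nNT; have [N0 NS NU] := sigma_ideal_set_ideal sN.
split; first split.
- by move=> f [].
- split; first by move=> x; exact: cvg_cst.
  by apply: NS N0 => t /=; rewrite eqxx.
- move=> f g [cf Nf] [cg Ng]; split; first by move=> x; apply: cvgD; [exact: cf|exact: cg].
  apply: NS (NU _ _ Nf Ng) => t /=; apply: contraPP => /not_orP[].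
  move=> /negP/negPn/eqP f0 /negP/negPn/eqP g0.
  by rewrite !fctE f0 g0 addr0 eqxx.
- move=> c f [cf Nf]; split; first by move=> x; apply: cvgZl_tmp; exact: cf.
  apply: NS Nf => t /=; apply: contra_neq => f0.
  by rewrite !fctE f0 scaler0.
- move=> f g cf [cg Ng]; split; first by move=> x; apply: cvgM; [exact: cf|exact: cg].
  apply: NS Ng => t /=; apply: contra_neq => g0.
  by rewrite !fctE g0 mulr0.
exists (fun=> 1); split.
- by move=> x; exact: cvg_cst.
- by move=> [_ N1]; apply: nNT; apply: NS N1 => t _ /=; exact: oner_neq0.
- move=> f cf; have [c Nc] := sigma_ideal_ae_constant (f \o pt) sN pN.
  exists c; split.
    move=> x; apply: cvgB; first exact: cf.
    by apply: cvgZl_tmp; exact: cvg_cst.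
  apply: NS Nc => t /=; apply: contra_neq => fc.
  by rewrite !fctE fc /GRing.scale /= mulr1 subrr.
Qed.

(** * Realcompactness *)

(** The points [pt t] lie in distinct components, so the component of any point
    [p] contains at most one of them; its indicator vanishes at almost all
    [pt t] but not at [p]. *)
Lemma realcompact_not_sigma_measurable (R : realType) (M : topologicalType) :
  (forall x : M, exists2 W, nbhs x W & connected W) ->
  realcompact R M -> ~ sigma_measurable_card R (components M).
Proof.
move=> lcM [_ rcM] [X [XK [mu [mu01 free_mu ntriv]]]].
have [sN pN] := zero_one_sigma_measureP mu01.
have [N0 NS _] := sigma_ideal_set_ideal sN.
have nNT : mu setT <> 0.
  by move=> muT; apply: ntriv => A; exact: NS (@subsetT _ A) muT.
have /pcard_eqP/unsquash f := XK.
have /choice[pt ptf] t : exists x, connected_component setT x = f t.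
  by have [x _ <-] : components M (f t) by [apply: funS]; exists x.
have [iJ dJ] := @ae_vanishing_idealP R M X _ pt sN pN nNT.
have [p Jp] := rcM _ iJ dJ.
pose C := connected_component setT p.
have cC : clopen C.
  apply: clopen_saturated => // x Cx y xy; exact: connected_component_trans xy.
have : ae_vanishing_ideal (fun A => mu A = 0) pt (\1_C : M -> R).
  split; first exact: continuous_indic_clopen.
  have ptC t : (\1_C (pt t) : R) != 0 -> f t = C.
    rewrite indicE; have [|] := boolP (pt t \in C); last by rewrite eqxx.
    by rewrite inE => /same_connected_component pC _; rewrite -ptf -pC.
  have [[t0 /ptC ft0]|/forallNP none] :=
      pselect (exists t, (\1_C (pt t) : R) != 0); last first.
    by apply: NS N0 => t /none.
  apply: NS (free_mu t0) => t /ptC ft /=.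
  have ftt0 : f t = f t0 by rewrite ft ft0.
  by apply: 'inj_f ftt0; rewrite inE.
rewrite Jp => -[_]; rewrite indicE mem_set; last exact: connected_component_refl.
exact/eqP/oner_neq0.
Qed.

(** If [I] had no common zero, all points would have null neighborhoods, hence
    all components would be null, and the sets of components with a null union
    would be the null sets of a free nontrivial measure. *)
Lemma not_sigma_measurable_fixed (R : realType) (M : topologicalType)
    (I : set (M -> R)) :
  (forall x : M, exists2 W, nbhs x W & connected W) ->
  (forall x : M, exists2 K, nbhs x K & compact K) ->
  paracompact M -> ~ sigma_measurable_card R (components M) ->
  cfun_ideal I -> codim1 I -> exists p, forall f, I f -> f p = 0.
Proof.
move=> lcoM lkM pM nsM iI dI; apply: contrapT => nfix; apply: nsM.
have sI := ideal_null_sigma iI dI; have [N0 NS NU] := ideal_null_set_ideal iI.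
have Ncomp : forall x, ideal_null I (connected_component setT x).
  apply: paracompact_component_ideal => // x.
  have /existsNP[f /not_implyP[If /eqP fx]] : ~ forall f, I f -> f x = 0.
    by move=> fx0; apply: nfix; exists x.
  exists [set y | f y != 0]; last by exists f.
  have [Icts _ _ _ _] := iI.
  exact: (@cvgr_neq0 _ R^o _ (nbhs x) _ f (f x) (Icts _ If x) fx).
(* The quotient map onto the set of components: a set of components is
   negligible when its preimage, a clopen set, is null for [I]. *)
pose k (x : M) : components M :=
  SigSub (mem_set (imageT (connected_component setT) x)).
pose N (S : set (components M)) := ideal_null I (k @^-1` S).
have sN : sigma_ideal N.
  split=> [|A B AB|F NF]; rewrite /N.
  - by rewrite preimage_set0.
  - by apply: NS; exact: preimage_subset.
  - by rewrite preimage_bigcup; exact: (sigma_ideal_bigcup sI).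
have pN : prime_ideal N.
  move=> S; apply: ideal_null_prime => //; apply: clopen_saturated => // x Sx y xy.
  rewrite /preimage/=; have -> // : k y = k x.
  by apply/val_inj; rewrite /= (same_connected_component xy).
exists (components M); split; first exact: card_setT.
exists (@ideal_measure R _ N); split.
- exact: ideal_measure_zero_one.
- move=> C; rewrite /ideal_measure; case: pselect => // -[].
  have [x _ xC] : components M (val C) by exact/set_mem/valP.
  apply: NS (Ncomp x) => y /= yC; rewrite xC -yC /=.
  exact: connected_component_refl.
- move=> /(_ setT); rewrite /ideal_measure; case: pselect => [NT _|_ /eqP].
    exact: (codim1_proper iI dI).
  by rewrite oner_eq0.
Qed.

Theorem theorem2 (R : realType) (M : topologicalType)
    (A : set (chart R M)) (hA : smooth_atlas A)
    (hausM : hausdorff_space M) (paraM : paracompact M) :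
  realcompact R M <-> ~ sigma_measurable_card R (components M).
Proof.
have nbhsM (x : M) : exists K : set M, [/\ nbhs x K, compact K & connected K].
  have [cover _] := hA; have : [set: M] x by [].
  by rewrite -cover => -[c _]; exact: chart_compact_connected_nbhs.
have lcoM (x : M) : exists2 W : set M, nbhs x W & connected W.
  by have [K [xK _ cK]] := nbhsM x; exists K.
have lkM (x : M) : exists2 K : set M, nbhs x K & compact K.
  by have [K [xK cK _]] := nbhsM x; exists K.
split=> [|nsM]; first exact: realcompact_not_sigma_measurable.
split.
  apply: (@locally_compact_completely_regular M R) => // x _.
  rewrite withinET; have [K xK cK] := lkM x.
  by exists K => //; split => //; exact: compact_closed.
move=> I iI dI.
have [p Ip] := not_sigma_measurable_fixed lcoM lkM paraM nsM iI dI.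
by exists p; exact: codim1_fixed.
Qed.
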